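(* Let $n\ge 0$ be an integer, let $a_i^-\le a_i^+$ ($i=0,\ldots,n$) be fixed real numbers such that $a_n^-\neq 0$ or $a_n^+\neq 0$, and such that $a_i^-<a_i^+$ for at least one $i$, and let $$P=\Big\{\,p : p(z)=\sum_{i=0}^n a_i z^i,\ a_i\in[a_i^-,a_i^+]\,\Big\}$$ be the corresponding interval polynomial of order $n$. Then $P$ is Hurwitz stable (i.e. every polynomial in $P$ is Hurwitz stable) if and only if the four Kharitonov polynomials $k_1,k_2,k_3,k_4$ associated with $P$ are Hurwitz stable.
   Context: A polynomial $p(z)$ is called Hurwitz stable if all its roots lie in the open left half-plane $\{z\in\mathbb{C}:\operatorname{Re} z<0\}$. (In particular nonzero constants are Hurwitz stable, and the zero polynomial, for which every complex number is a root, is not.) Both the degree invariant case $a_n^-a_n^+\neq 0$ and the degree drop case $a_n^-a_n^+=0$ are allowed. The Kharitonov polynomials associated with $P$ are the four elements of $P$ $$k_1=a_0^{-}+a_1^{-}z+a_2^{+}z^2+a_3^{+}z^3+\cdots,$$ $$k_2=a_0^{+}+a_1^{-}z+a_2^{-}z^2+a_3^{+}z^3+\cdots,$$ $$k_3=a_0^{+}+a_1^{+}z+a_2^{-}z^2+a_3^{-}z^3+\cdots,$$ $$k_4=a_0^{-}+a_1^{+}z+a_2^{+}z^2+a_3^{-}z^3+\cdots,$$ where each sum runs over the powers $z^0,\ldots,z^n$ and the pattern of superscripts $\pm$ is periodic in the index $i$ with period $4$. That is, the coefficient of $z^i$ is $a_i^+$ exactly when $i \bmod 4$ belongs to $\{2,3\}$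 for $k_1$, $\{0,3\}$ for $k_2$, $\{0,1\}$ for $k_3$, $\{1,2\}$ for $k_4$, and is $a_i^-$ otherwise.
   Formalization: For n = 0 the formal theorem additionally assumes that a_0^- < 0 < a_0^+ does not hold, since then all four Kharitonov polynomials are nonzero constants (stable) while P contains the zero polynomial (unstable), so the claim as written fails. *)

(* Defs.v *)
From HB Require Import structures.
From mathcomp Require Import all_boot all_order all_algebra.
From mathcomp Require Import reals classical_sets.
From mathcomp Require Import complex.

Set Implicit Arguments.
Unset Strict Implicit.
Unset Printing Implicit Defensive.
Import Order.TTheory GRing.Theory Num.Theory.
Local Open Scope ring_scope.
Local Open Scope complex_scope.
Local Open Scope classical_set_scope.

(* Every complex number is a root of 0, so 0 is not Hurwitz stable, while
   nonzero constants are, vacuously. *)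
Definition hurwitz_stable (R : realType) (p : {poly R}) : Prop :=
  forall z : R[i], root (map_poly (real_complex R) p) z -> complex.Re z < 0.

Definition poly_of_coefs (R : realType) (n : nat) (a : 'I_n.+1 -> R) : {poly R} :=
  \sum_(i < n.+1) a i *: 'X^i.

Definition interval_poly (R : realType) (n : nat) (am ap : 'I_n.+1 -> R) :
    set {poly R} :=
  [set p | exists2 a : 'I_n.+1 -> R,
     (forall i, am i <= a i <= ap i) & p = poly_of_coefs a].

Definition interval_hurwitz_stable (R : realType) (P : set {poly R}) : Prop :=
  forall p, P p -> hurwitz_stable p.

(* [s] lists the residues mod 4 of the indices carrying the upper endpoint. *)
Definition kharitonov (R : realType) (n : nat) (am ap : 'I_n.+1 -> R)
    (s : seq nat) : {poly R} :=
  poly_of_coefs (fun i : 'I_n.+1 => if (i %% 4)%N \in s then ap i else am i).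

Definition kharitonov1 (R : realType) (n : nat) (am ap : 'I_n.+1 -> R) :=
  kharitonov am ap [:: 2; 3]%N.
Definition kharitonov2 (R : realType) (n : nat) (am ap : 'I_n.+1 -> R) :=
  kharitonov am ap [:: 0; 3]%N.
Definition kharitonov3 (R : realType) (n : nat) (am ap : 'I_n.+1 -> R) :=
  kharitonov am ap [:: 0; 1]%N.
Definition kharitonov4 (R : realType) (n : nat) (am ap : 'I_n.+1 -> R) :=
  kharitonov am ap [:: 1; 2]%N.

(* Main.v *)
Require Import Defs.
From HB Require Import structures.
From mathcomp Require Import all_boot all_order all_algebra.
From mathcomp Require Import reals classical_sets.
From mathcomp Require Import complex.
From mathcomp Require Import ring lra.

Set Implicit Arguments.
Unset Strict Implicit.
Unset Printing Implicit Defensive.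
Import Order.TTheory GRing.Theory Num.Theory.
Local Open Scope ring_scope.

(** Call [f] and [g] the ends of the segment [blend f g t = f + t (g - f)].  The
    proof compares polynomials through their values at the points [iw] of the
    imaginary axis, where the even part of a real polynomial gives the real
    part of the value, and the odd part the imaginary part.

    Zero exclusion (zero_exclusion).  If [f] is stable and no member of the
    segment from [f] to [g] vanishes on the imaginary axis, then [g] is stable,
    provided that the degree is constant on the segment, except perhaps at [g].
    Stability persists near a stable member of full degree, because a stable
    polynomial dominates every polynomial of no larger degree on the right
    half-plane (stable_dominates).  It passes to limits, because a stable polynomial [f]
    satisfies [|f (x + iy)| >= |f (iy)|] for [x >= 0] (stable_le_imag), and
    this inequality survives even when the degree drops.

    Convex directions (stable_blend).  If [f] and [g] are stable and [g - f] is
    even or odd, the whole segment is stable.  Were it to vanish at [iw], the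
    values [f (iw)] and [g (iw)] would have opposite directions.  Moving up the
    axis, the values of nonconstant stable polynomials turn counterclockwise, so
    the difference would turn too; but an even or odd polynomial stays on a
    fixed line through the origin.

    Kharitonov's theorem.  The differences [k2 - k1] and [k3 - k4] are even,
    [k4 - k1] and [k3 - k2] are odd.  Hence the bilinear hull of the four
    polynomials, obtained by three blends in convex directions, is stable
    (hull_stable).  At [iw] its values fill the rectangle spanned by the four
    values, which contains the values of the whole box, so that no polynomial
    of the box vanishes on the imaginary axis (box_imag_neq0).  Zero exclusion
    from a Kharitonov polynomial of maximal degree finishes the proof.

    The degree is controlled by the two top coefficients.  Two consecutive
    coefficients take all four combinations of endpoints among the four
    polynomials, and the two top coefficients of a nonconstant stable polynomial
    have the same sign; so over the whole box the coefficient below the top has one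
    strict sign, shared by the top one where that does not vanish
    (box_top_sign).  The degree drops by at most one, and never inside a
    segment.  Intervals of constants and of polynomials of degree at most 1 are
    settled by inspection. *)

(** * Real polynomials at complex points *)

Section HurwitzStability.
Variable R : realType.
Implicit Types (f g q : {poly R}) (z r : R[i]) (s t w : R).
Local Notation Re := (@complex.Re R).
Local Notation Im := (@complex.Im R).
Local Notation toC := (real_complex R).
Local Notation mapC := (map_poly (real_complex R)).
Local Notation hstable := (@hurwitz_stable R).

Lemma ReD z r : Re (z + r) = Re z + Re r.
Proof. by case: z r => [? ?] []. Qed.
Lemma ImD z r : Im (z + r) = Im z + Im r.
Proof. by case: z r => [? ?] []. Qed.
Lemma ReM z r : Re (z * r) = Re z * Re r - Im z * Im r.
Proof. by case: z r => [? ?] []. Qed.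
Lemma ImM z r : Im (z * r) = Re z * Im r + Im z * Re r.
Proof. by case: z r => [? ?] []. Qed.
Lemma ReN z : Re (- z) = - Re z. Proof. by case: z. Qed.
Lemma ImN z : Im (- z) = - Im z. Proof. by case: z. Qed.

(** The modulus as a real number, so that bounds can be compared with real
    parameters. *)
Definition cmod z : R := Num.sqrt (Re z ^+ 2 + Im z ^+ 2).

Lemma cmodE z : toC (cmod z) = `|z|. Proof. by rewrite normc_def. Qed.

Lemma cmod_ge0 z : 0 <= cmod z. Proof. exact: sqrtr_ge0. Qed.

Lemma cmodM z r : cmod (z * r) = cmod z * cmod r.
Proof. by apply: (@complexI R); rewrite rmorphM /= !cmodE normrM. Qed.

Lemma cmodD z r : cmod (z + r) <= cmod z + cmod r.
Proof. by rewrite -lecR rmorphD /= !cmodE ler_normD. Qed.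

Lemma cmodN z : cmod (- z) = cmod z.
Proof. by apply: (@complexI R); rewrite !cmodE normrN. Qed.

Lemma cmodR t : cmod (toC t) = `|t|.
Proof. by rewrite /cmod /= expr0n addr0 sqrtr_sqr. Qed.

Lemma cmod_eq0 z : (cmod z == 0) = (z == 0).
Proof. by rewrite -[RHS]normr_eq0 -cmodE -(inj_eq (@complexI R)). Qed.

Lemma cmod_ge_Re z : `|Re z| <= cmod z.
Proof. by rewrite -lecR cmodE normc_ge_Re. Qed.

Lemma cmodX z n : cmod (z ^+ n) = cmod z ^+ n.
Proof. by apply: (@complexI R); rewrite rmorphXn /= !cmodE normrX. Qed.

Definition cev f z : R[i] := (mapC f).[z].

Lemma cevD f g z : cev (f + g) z = cev f z + cev g z.
Proof. by rewrite /cev rmorphD hornerD. Qed.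
Lemma cevB f g z : cev (f - g) z = cev f z - cev g z.
Proof. by rewrite /cev rmorphB hornerD hornerN. Qed.
Lemma cevZ t f z : cev (t *: f) z = toC t * cev f z.
Proof. by rewrite /cev map_polyZ hornerZ. Qed.

Lemma cev_sum f z n : (size f <= n)%N ->
  cev f z = \sum_(i < n) toC f`_i * z ^+ i.
Proof.
move=> fn; rewrite /cev (@horner_coef_wide _ n) ?size_map_poly //.
by apply: eq_bigr => i _; rewrite coef_map.
Qed.

(** * Roots of stable polynomials *)

Lemma stableP f :
  hstable f <-> forall z, 0 <= Re z -> cev f z != 0.
Proof.
split=> [fs z z0 | h z rz].
  by apply/negP => /fs; rewrite ltNge z0.
by rewrite ltNge; apply/negP => /h; rewrite -rootE rz.
Qed.

Definition in_lhp (rs : seq R[i]) := {in rs, forall r, Re r < 0}.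

Lemma in_lhp_cons r rs : in_lhp (r :: rs) -> Re r < 0 /\ in_lhp rs.
Proof.
move=> h; split; first by apply: h; rewrite mem_head.
by move=> x xrs; apply: h; rewrite in_cons xrs orbT.
Qed.

Lemma stable_neq0 f : hstable f -> f != 0.
Proof.
move=> /stableP /(_ 0 (lexx _)); apply: contraNneq => ->.
by rewrite /cev rmorph0 horner0.
Qed.

Lemma stable_factor f : hstable f -> exists2 rs : seq R[i],
  in_lhp rs & mapC f = toC (lead_coef f) *: \prod_(r <- rs) ('X - r%:P).
Proof.
move=> fs; have [rs Ef] := closed_field_poly_normal (mapC f).
rewrite lead_coef_map in Ef.
exists rs => // r rrs; apply: fs.
by rewrite rootE Ef hornerZ horner_prod (big_rem r) //= hornerXsubC subrr mul0r mulr0.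
Qed.

Lemma size_factor f rs : f != 0 ->
  mapC f = toC (lead_coef f) *: \prod_(r <- rs) ('X - r%:P) ->
  size f = (size rs).+1.
Proof.
move=> f0 Ef; rewrite -(size_map_poly (real_complex R) f) Ef size_scale ?size_prod_XsubC //.
by rewrite fmorph_eq0 lead_coef_eq0.
Qed.

Lemma cev_factor f rs z :
  mapC f = toC (lead_coef f) *: \prod_(r <- rs) ('X - r%:P) ->
  cev f z = toC (lead_coef f) * \prod_(r <- rs) (z - r).
Proof.
move=> Ef; rewrite /cev Ef hornerZ horner_prod; congr (_ * _).
by apply: eq_bigr => r _; rewrite hornerXsubC.
Qed.

Definition imag w : R[i] := Complex 0 w.

(** Every root has negative real part, so moving a point of the right
    half-plane horizontally to the imaginary axis brings it closer to all the
    roots.  In a limit of stable polynomials this rules out roots with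
    positive real part as soon as the limit has none on the axis, without any
    control of the degree. *)
Lemma stable_le_imag f z : hstable f -> 0 <= Re z ->
  cmod (cev f (imag (Im z))) <= cmod (cev f z).
Proof.
move=> fs z0; have [rs rsn Ef] := stable_factor fs.
rewrite !(cev_factor _ Ef) !cmodM ler_wpM2l ?cmod_ge0 //.
elim: rs rsn {Ef} => [|r rs IH] h; first by rewrite !big_nil.
have [r0 rsn] := in_lhp_cons h.
rewrite !big_cons !cmodM ler_pM ?cmod_ge0 ?IH //.
rewrite ler_wsqrtr // !ReD !ImD !ReN !ImN lerD2r /=.
by nra.
Qed.

Lemma lhp_prod_growth rs : in_lhp rs ->
  exists2 K, 0 <= K & forall z, 0 <= Re z ->
    (1 + cmod z) ^+ size rs <= K * cmod (\prod_(r <- rs) (z - r)).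
Proof.
elim: rs => [_|r rs IH /in_lhp_cons[r0 /IH[K K0 hK]]].
  by exists 1 => // z _; rewrite big_nil -(rmorph1 (real_complex R)) cmodR normr1 mulr1.
(* both 1 and |z| are at most a multiple of |z - r|, as |z - r| >= - Re r *)
pose a := - Re r; have a0 : 0 < a by rewrite oppr_gt0.
have rm := cmod_ge0 r.
exists ((1 + (1 + cmod r) / a) * K).
  by rewrite mulr_ge0 ?addr_ge0 ?divr_ge0 ?(ltW a0) // addr_ge0.
move=> z z0; rewrite big_cons cmodM exprS.
have za : a <= cmod (z - r).
  apply: le_trans (cmod_ge_Re _); rewrite ReD ReN -/a.
  by apply: le_trans (ler_norm _); rewrite lerDr.
have zr : cmod z <= cmod (z - r) + cmod r.
  by rewrite -{1}(subrK r z) cmodD.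
have h1 : 1 + cmod z <= (1 + (1 + cmod r) / a) * cmod (z - r).
  have : 1 + cmod r <= (1 + cmod r) / a * cmod (z - r).
    by rewrite -mulrA ler_peMr ?addr_ge0 // mulrC ler_pdivlMr ?mul1r.
  by lra.
rewrite mulrACA ler_pM ?hK ?exprn_ge0 ?addr_ge0 ?cmod_ge0 //.
Qed.

(** On the right half-plane, a stable polynomial of degree [d] dominates every
    polynomial of degree at most [d]: each factor [z - r] stays away from 0
    and grows like [z]. *)
Lemma stable_dominates f q : hstable f -> (size q <= size f)%N ->
  exists2 C, 0 <= C & forall z, 0 <= Re z -> cmod (cev q z) <= C * cmod (cev f z).
Proof.
move=> fs qf; have [rs rsn Ef] := stable_factor fs.
have f0 := stable_neq0 fs.
have [K K0 hK] := lhp_prod_growth rsn.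
have sf := size_factor f0 Ef; rewrite sf in qf.
have l0 : 0 < `|lead_coef f| by rewrite normr_gt0 lead_coef_eq0.
pose S := \sum_(i < (size rs).+1) `|q`_i|.
have S0 : 0 <= S by apply: sumr_ge0.
exists (S * K / `|lead_coef f|); first by rewrite divr_ge0 ?mulr_ge0.
move=> z z0; rewrite (cev_factor _ Ef) cmodM cmodR.
rewrite mulrA divfK ?gt_eqF // -mulrA.
apply: le_trans (_ : S * (1 + cmod z) ^+ size rs <= _); last first.
  by rewrite ler_wpM2l ?hK.
rewrite (cev_sum _ qf) mulr_suml.
elim/big_rec2: _ => [|i x y _ xy].
  by rewrite -(rmorph0 (real_complex R)) cmodR normr0.
apply: le_trans (cmodD _ _) _; apply: lerD => //.
rewrite cmodM cmodR cmodX ler_wpM2l //.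
apply: le_trans (_ : (1 + cmod z) ^+ i <= _).
  by rewrite lerXn2r ?nnegrE ?addr_ge0 ?cmod_ge0 // lerDr.
by rewrite ler_weXn2l ?lerDl ?cmod_ge0 // -ltnS.
Qed.

(** * Zero exclusion *)

(** The perturbation [s q] is smaller than [f] on the whole right half-plane. *)
Lemma stable_open f q : hstable f -> (size q <= size f)%N ->
  exists2 d, 0 < d & forall s, `|s| < d -> hstable (f + s *: q).
Proof.
move=> fs qf; have [C C0 hC] := stable_dominates fs qf.
have C1 : 0 < C + 1 by rewrite ltr_wpDl.
exists (C + 1)^-1; first by rewrite invr_gt0.
move=> s sd; apply/stableP => z z0; apply/negP; rewrite cevD cevZ addr_eq0 => /eqP E.
have fz : 0 < cmod (cev f z).
  by rewrite lt_neqAle eq_sym cmod_eq0 cmod_ge0 andbT; move/stableP: fs; apply.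
have : cmod (cev f z) <= `|s| * (C * cmod (cev f z)).
  by rewrite {1}E cmodN cmodM cmodR ler_wpM2l ?hC.
apply/negP; rewrite -ltNge mulrA gtr_pMl //.
have : `|s| * (C + 1) < 1 by rewrite -ltr_pdivlMr // mul1r.
by have := normr_ge0 s; nra.
Qed.

Lemma cev_conj f z : cev f (conjc z) = conjc (cev f z).
Proof.
rewrite /cev -horner_map -map_poly_comp; congr horner.
by apply: eq_map_poly => x /=; rewrite oppr0.
Qed.

(** At a hypothetical root [z] of the limit, the nearby stable members are
    small at [z], but not at the point of the imaginary axis at the same height,
    against stable_le_imag.  By conjugation, [z] may be taken in the upper
    half-plane. *)
Lemma stable_closed f q t :
    (forall w, 0 <= w -> cev (f + t *: q) (imag w) != 0) ->
    (forall e, 0 < e -> exists2 s, `|s - t| < e & hstable (f + s *: q)) ->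
  hstable (f + t *: q).
Proof.
move=> ht happ; apply/stableP => z z0; apply/negP => /eqP.
wlog w0 : z z0 / 0 <= Im z => [hwlog|] Ez.
  have [/hwlog|w0] := leP 0 (Im z); first exact.
  apply: (hwlog (conjc z)); last by rewrite cev_conj Ez conjc0.
    by case: z z0 {w0 Ez}.
  by case: z z0 {Ez} w0 => a b /= _; rewrite oppr_ge0 => /ltW.
pose y := imag (Im z).
have y0 : 0 < cmod (cev (f + t *: q) y).
  by rewrite lt_neqAle eq_sym cmod_eq0 cmod_ge0 ht.
pose B := cmod (cev q y) + cmod (cev q z) + 1.
have B0 : 0 < B by rewrite ltr_wpDl ?addr_ge0 ?cmod_ge0.
have [s sd /stable_le_imag /(_ z0)] := happ _ (divr_gt0 y0 B0).
have Es x : cev (f + s *: q) x = cev (f + t *: q) x + toC (s - t) * cev q x.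
  by rewrite !cevD !cevZ rmorphB /=; ring.
rewrite -/y !Es Ez add0r cmodM cmodR => hle.
have : cmod (cev (f + t *: q) y) <=
    cmod (cev (f + t *: q) y + toC (s - t) * cev q y) + `|s - t| * cmod (cev q y).
  have := cmodD (cev (f + t *: q) y + toC (s - t) * cev q y) (- (toC (s - t) * cev q y)).
  by rewrite addrK cmodN cmodM cmodR.
move: sd; rewrite ltr_pdivlMr // /B.
by have := normr_ge0 (s - t); lra.
Qed.

Definition blend f g t := f + t *: (g - f).

Lemma cev_blend f g t z :
  cev (blend f g t) z = cev f z + toC t * (cev g z - cev f z).
Proof. by rewrite /blend cevD cevZ cevB. Qed.

Lemma blend0 f g : blend f g 0 = f.
Proof. by rewrite /blend scale0r addr0. Qed.

Lemma blend1 f g : blend f g 1 = g.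
Proof. by rewrite /blend scale1r addrC subrK. Qed.

Lemma blendC f g t : blend f g t = blend g f (1 - t).
Proof. by rewrite /blend scalerBl scale1r -(opprB g f) scalerN; ring. Qed.

Lemma blend_blend f g t s : blend f (blend f g t) s = blend f g (s * t).
Proof. by rewrite /blend addrAC subrr add0r scalerA. Qed.

Lemma coef_blend f g t i : (blend f g t)`_i = f`_i + t * (g`_i - f`_i).
Proof. by rewrite coefD coefZ coefB. Qed.

Lemma size_blend_le f g t n :
  (size f <= n)%N -> (size g <= n)%N -> (size (blend f g t) <= n)%N.
Proof.
move=> fn gn; apply/leq_sizeP => j nj; rewrite coef_blend.
by rewrite !nth_default ?(leq_trans fn) ?(leq_trans gn) // subr0 mulr0 addr0.
Qed.

(** The leading coefficient of [f] and the coefficient of [g] of the same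
    index do not have opposite signs, so the degree is constant from [f] up to,
    but possibly not including, [g]. *)
Definition degree_compatible f g :=
  (size g <= size f)%N /\ 0 <= lead_coef f * g`_(size f).-1.

Lemma size_blend f g t : degree_compatible f g -> f != 0 -> 0 <= t < 1 ->
  size (blend f g t) = size f.
Proof.
move=> [gf l0] f0 /andP[t0 t1]; apply/eqP; rewrite eqn_leq size_blend_le //=.
have sf : (0 < size f)%N by rewrite size_poly_gt0.
rewrite -(prednK sf) ltnNge; apply/negP => /leq_sizeP/(_ _ (leqnn _)).
rewrite coef_blend -lead_coefE => E.
have := congr1 ( *%R (lead_coef f)) E; rewrite mulr0.
have : 0 < lead_coef f ^+ 2 by rewrite exprn_even_gt0 // lead_coef_eq0.
by nra.
Qed.

(** Zero exclusion: along a segment of real polynomials without zeros on the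
    imaginary axis, stability can neither be lost at a limit (stable_closed),
    even if the degree drops there, nor right after a stable member of full
    degree (stable_open). *)
Lemma zero_exclusion f g : hstable f -> degree_compatible f g ->
  (forall t w, 0 <= t <= 1 -> 0 <= w -> cev (blend f g t) (imag w) != 0) -> hstable g.
Proof.
move=> fs fg himag; have f0 := stable_neq0 fs.
(* the parameters up to which the segment is stable; the supremum is 1 *)
pose S : classical_sets.set R :=
  [set t | 0 <= t <= 1 /\ forall s, 0 <= s <= t -> hstable (blend f g s)]%classic.
have S0 : S 0.
  split=> [|s /le_anti <-]; first by rewrite lexx ler01.
  by rewrite blend0.
have supS : has_sup S by split; [exists 0 | exists 1 => t [/andP[]]].
pose T := sup S.
have T0 : 0 <= T by apply: ub_le_sup => //; case: supS.
have T1 : T <= 1 by apply: ge_sup; [exists 0 | move=> t [/andP[]]].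
have below s : 0 <= s < T -> hstable (blend f g s).
  move=> /andP[s0 sT]; have [|x [_ hx]] := @sup_adherent _ S (T - s) _ supS.
    by rewrite subr_gt0.
  by rewrite subKr => /ltW sx; apply: hx; rewrite s0.
have atT : hstable (blend f g T).
  apply: stable_closed => [w w0|e e0]; first by apply: himag; rewrite ?T0.
  have [x Sx xT] := sup_adherent e0 supS.
  have xleT : x <= T by apply: ub_le_sup => //; case: supS.
  exists x; last by case: Sx => /andP[x0 _]; apply; rewrite x0 lexx.
  by rewrite ler0_norm ?subr_le0 // opprB ltrBlDr -ltrBlDl.
have [TE|Tlt1] : T = 1 \/ T < 1 by move: T1; rewrite le_eqVlt => /predU1P.
  by rewrite TE blend1 in atT.
have [|d d0 hd] := @stable_open _ (g - f) atT.
  rewrite size_blend ?T0 //; apply/leq_sizeP => j fj.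
  by rewrite coefB !nth_default ?subr0 // (leq_trans _ fj) //; case: fg.
have : S (Num.min 1 (T + d / 2)).
  split=> [|s /andP[s0]]; first by rewrite ge_min lexx le_min ler01 addr_ge0 // ltW // divr_gt0.
  rewrite le_min => /andP[s1 sd].
  have [sT|Ts] := ltP s T; first by apply: below; rewrite s0.
  rewrite (_ : blend f g s = blend f g T + (s - T) *: (g - f)).
    by apply: hd; rewrite ger0_norm ?subr_ge0 //; lra.
  by rewrite /blend -addrA -scalerDl [T + _]addrC subrK.
move/(ub_le_sup (proj2 supS)); rewrite -/T ge_min => /orP[]; lra.
Qed.

(** * Convex directions *)

(** The scalar product of the plane, [Re (z * conj r)]. *)
Definition dotc z r := Re z * Re r + Im z * Im r.

(** The product rule gives [Re (F' F^* ) = |F|^2 \sum_r Re (1 / (z - r))] for a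
    product [F] of factors [z - r], and each term of this sum is positive on
    the imaginary axis. *)
Lemma lhp_prod_deriv rs w : in_lhp rs ->
  let F := \prod_(r <- rs) ('X - r%:P) in
  [/\ F.[imag w] != 0, 0 <= dotc (F^`()).[imag w] F.[imag w]
    & (0 < size rs)%N -> 0 < dotc (F^`()).[imag w] F.[imag w]].
Proof.
elim: rs => [_|r rs IH /in_lhp_cons[r0 /IH]] /=.
  by rewrite big_nil derivC !hornerE oner_neq0 /dotc /= !mul0r addr0.
rewrite big_cons; set G := \prod_(_ <- _) _ => -[G0 dG _].
rewrite derivM derivXsubC mul1r hornerD !hornerM hornerXsubC.
move: G0 dG; set u := G.[_]; set v := (G^`()).[_] => u0 dG.
have xr0 : 0 < Re (imag w - r) by rewrite ReD ReN /= add0r oppr_gt0.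
have u2 : 0 < Re u ^+ 2 + Im u ^+ 2.
  by rewrite -(ltcR 0) add_Re2_Im2 exprn_gt0 // normr_gt0.
have pos : 0 < dotc (u + (imag w - r) * v) ((imag w - r) * u).
  have -> : dotc (u + (imag w - r) * v) ((imag w - r) * u) =
      (Re u ^+ 2 + Im u ^+ 2) * Re (imag w - r) +
      (Re (imag w - r) ^+ 2 + Im (imag w - r) ^+ 2) * dotc v u.
    by rewrite /dotc !ReD !ImD !ReM !ImM; ring.
  by rewrite ltr_wpDr ?mulr_gt0 // mulr_ge0 // addr_ge0 ?sqr_ge0.
split=> [||_] //; last exact: ltW.
rewrite mulf_neq0 //; apply: contraTneq xr0 => ->; by rewrite /= ltxx.
Qed.

(** On the imaginary axis the argument of a nonconstant stable polynomial is
    strictly increasing; [dotc f' f] is its rate of change up to the factor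
    [|f|^2]. *)
Lemma stable_arg_incr f w : hstable f ->
  0 <= dotc (cev f^`() (imag w)) (cev f (imag w)) /\
  ((1 < size f)%N -> 0 < dotc (cev f^`() (imag w)) (cev f (imag w))).
Proof.
move=> fs; have [rs rsn Ef] := stable_factor fs.
have f0 := stable_neq0 fs; have sf := size_factor f0 Ef.
have [_ d0 d1] := lhp_prod_deriv w rsn.
have l0 : 0 < lead_coef f ^+ 2 by rewrite exprn_even_gt0 // lead_coef_eq0.
have E : dotc (cev f^`() (imag w)) (cev f (imag w)) = lead_coef f ^+ 2 *
    dotc ((\prod_(r <- rs) ('X - r%:P))^`()).[imag w]
         (\prod_(r <- rs) ('X - r%:P)).[imag w].
  by rewrite /cev -deriv_map Ef derivZ !hornerZ /dotc !ReM !ImM /=; ring.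
rewrite E sf ltnS; split=> [|/d1 ?]; last exact: mulr_gt0.
by rewrite mulr_ge0 // ltW.
Qed.

(** By Vieta, the ratio of the two top coefficients is minus the sum of the
    roots, which has positive real part. *)
Lemma stable_top_coefs f n : hstable f -> (size f <= n.+2)%N ->
  f`_n.+1 != 0 -> 0 < f`_n.+1 * f`_n.
Proof.
move=> fs fn f1; have [rs rsn Ef] := stable_factor fs.
have f0 := stable_neq0 fs; have sf := size_factor f0 Ef.
have szf : size f = n.+2.
  by apply/eqP; rewrite eqn_leq fn ltnNge; apply: contra f1 => ?; rewrite nth_default.
have [srs] : (size rs).+1 = n.+2 by rewrite -sf.
have lE : f`_n.+1 = lead_coef f by rewrite lead_coefE szf.
have E : f`_n = lead_coef f * - \sum_(r <- rs) Re r.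
  have := congr1 (fun p : {poly R[i]} => Re p`_n) Ef.
  have := coefPn_prod_XsubC (ps := rs); rewrite srs => /(_ isT) /= Ec.
  rewrite coef_map coefZ Ec ReM /= mul0r subr0 ReN => ->.
  by congr (_ * - _); elim/big_rec2: _ => // r x y _ <-; rewrite ReD.
rewrite E lE mulrA -expr2 pmulr_rgt0 ?exprn_even_gt0 ?lead_coef_eq0 //.
rewrite oppr_gt0; case: rs rsn srs {Ef sf E} => // r rs /in_lhp_cons[r0 rsn] _.
rewrite big_cons ltr_wnDr //.
elim: rs rsn => [|x rs IH] h; first by rewrite big_nil.
by have [x0 /IH le0] := in_lhp_cons h; rewrite big_cons; lra.
Qed.

Lemma imagX w i : imag w ^+ i =
  if odd i then imag ((-1) ^+ i./2 * w ^+ i) else toC ((-1) ^+ i./2 * w ^+ i).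
Proof.
elim: i => [|i IH]; first by rewrite !expr0 mulr1.
rewrite exprS IH /= uphalf_half; case: (odd i); apply/eqP; rewrite eq_complex /=.
  by apply/andP; split; apply/eqP; rewrite ?add1n ?exprS; ring.
by apply/andP; split; apply/eqP; rewrite ?add0n ?exprS; ring.
Qed.

Lemma ReE f n w : (size f <= n)%N ->
  Re (cev f (imag w)) = \sum_(i < n) f`_i * Re (imag w ^+ i).
Proof.
move=> fn; rewrite (cev_sum _ fn).
elim/big_rec2: _ => // i x y _ <-; rewrite ReD ReM /=; ring.
Qed.

Lemma ImE f n w : (size f <= n)%N ->
  Im (cev f (imag w)) = \sum_(i < n) f`_i * Im (imag w ^+ i).
Proof.
move=> fn; rewrite (cev_sum _ fn).
elim/big_rec2: _ => // i x y _ <-; rewrite ImD ImM /=; ring.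
Qed.

Lemma Re_imagX w i : Re (imag w ^+ i) = if odd i then 0 else (-1) ^+ i./2 * w ^+ i.
Proof. by rewrite imagX; case: ifP. Qed.

Lemma Im_imagX w i : Im (imag w ^+ i) = if odd i then (-1) ^+ i./2 * w ^+ i else 0.
Proof. by rewrite imagX; case: ifP. Qed.

(** With [b = true] the polynomial is even, with [b = false] it is odd. *)
Definition no_coef_of_parity b q := forall i, odd i = b -> q`_i = 0.

Lemma Re_odd_poly q w : no_coef_of_parity false q -> Re (cev q (imag w)) = 0.
Proof.
move=> qb; rewrite (ReE _ (leqnn _)) big1 // => i _; rewrite Re_imagX.
by have [_|/negbTE/qb->] := boolP (odd i); rewrite ?mulr0 ?mul0r.
Qed.

Lemma Im_even_poly q w : no_coef_of_parity true q -> Im (cev q (imag w)) = 0.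
Proof.
move=> qb; rewrite (ImE _ (leqnn _)) big1 // => i _; rewrite Im_imagX.
by have [/qb->|_] := boolP (odd i); rewrite ?mulr0 ?mul0r.
Qed.

(** On the imaginary axis an even or odd polynomial moves along a line through
    the origin, so its argument does not change. *)
Lemma parity_arg_const b q w : no_coef_of_parity b q ->
  dotc (cev q^`() (imag w)) (cev q (imag w)) = 0.
Proof.
have deriv_parity c p : no_coef_of_parity c p -> no_coef_of_parity (~~ c) p^`().
  move=> pc i ic; rewrite coef_deriv pc ?mul0rn //=.
  by rewrite ic negbK.
rewrite /dotc; case: b => qb.
  by rewrite (Im_even_poly _ qb) (Re_odd_poly _ (deriv_parity _ _ qb)) mul0r mulr0 addr0.
by rewrite (Re_odd_poly _ qb) (Im_even_poly _ (deriv_parity _ _ qb)) mul0r mulr0 addr0.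
Qed.

(** An even or odd [g - f] is a convex direction for stability.  If a point of
    the segment vanished at some [iw], then [f (iw)] would be a negative and
    [g (iw)] a positive multiple of [(g - f) (iw)].  At [iw] the argument of
    [f] is strictly increasing and that of [g] is at least nondecreasing, so the
    argument of [g - f] would increase, whereas it is constant. *)
Lemma stable_blend b f g t : hstable f -> hstable g -> (1 < size f)%N ->
    degree_compatible f g -> no_coef_of_parity b (g - f) -> 0 <= t <= 1 ->
  hstable (blend f g t).
Proof.
move=> fs gs f1 [gf l0] qb /andP[t0 t1]; apply: (zero_exclusion fs).
  split; first exact: size_blend_le.
  rewrite coef_blend -lead_coefE.
  have -> : lead_coef f * (lead_coef f + t * (g`_(size f).-1 - lead_coef f)) =
      (1 - t) * lead_coef f ^+ 2 + t * (lead_coef f * g`_(size f).-1) by ring.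
  by apply: addr_ge0; apply: mulr_ge0; rewrite ?sqr_ge0 ?subr_ge0.
move=> s w /andP[s0 s1] _; rewrite blend_blend.
have u0 : 0 <= s * t by rewrite mulr_ge0.
have u1 : s * t <= 1 by rewrite mulr_ile1.
move: (s * t) u0 u1 => u u0 u1; rewrite cev_blend; apply/negP => /eqP E.
have [_ /(_ f1)] := stable_arg_incr w fs.
have [+ _] := stable_arg_incr w gs.
have := parity_arg_const w qb.
have : cev g (imag w) != 0 by move/stableP: gs; apply.
rewrite derivB !cevB; move: E.
set A := cev f _; set B := cev g _; set Q := B - A => E.
have EA : A = - (toC u * Q) by apply/eqP; rewrite -addr_eq0 E.
have EB : B = toC (1 - u) * Q.
  by rewrite rmorphB rmorph1 mulrBl mul1r -EA /Q; ring.
clearbody Q; rewrite EA EB.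
rewrite mulf_eq0 negb_or -(rmorph0 (real_complex R)) (inj_eq (@complexI R)) => /andP[u1' _].
have {}u1' : 0 < 1 - u by rewrite lt_def u1' subr_ge0.
rewrite /dotc !ReN !ImN !ReD !ImD !ReN !ImN !ReM !ImM /= !mul0r ?subr0 ?addr0.
move: (Re Q) (Im Q) (Re _) (Im _) (Re _) (Im _) => a c d e p q H1 H2 H3.
have {}H2 : 0 <= p * a + q * c by rewrite -(pmulr_rge0 _ u1'); lra.
have {}H1 : p * a + q * c = d * a + e * c by lra.
have : 0 <= u * (d * a + e * c) by rewrite mulr_ge0 // -H1.
by lra.
Qed.

(** * Signs of the two top coefficients *)

(** The sign is that of [e].  The weak inequality at the top coefficient is what
    admits a drop of the degree, the strict one below it limits the drop to 1. *)
Definition top_sign e n f :=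
  [/\ (size f <= n.+2)%N, 0 <= e * f`_n.+1 & 0 < e * f`_n].

Lemma top_sign_size e n f : top_sign e n f -> (n.+1 <= size f)%N.
Proof.
case=> _ _; rewrite ltnNge; apply: contraTN => sf.
by rewrite nth_default // mulr0 ltxx.
Qed.

(** A polynomial [a z + b] with [a >= 0] and [b > 0], up to a common sign, has
    positive real part on the right half-plane. *)
Lemma linear_stable e f : top_sign e 0 f -> hstable f.
Proof.
move=> [f2 f1 f0]; apply/stableP => z z0; apply/negP => /eqP /(congr1 Re).
rewrite (cev_sum _ f2) !big_ord_recl big_ord0 !ReD !ReM /= ?expr0 ?expr1 /= => h.
have : 0 <= e * f`_1 * Re z by rewrite mulr_ge0.
by move: h f0; rewrite /bump /=; nra.
Qed.

Lemma top_sign_compatible e n f g : top_sign e n f -> top_sign e n g ->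
  (size g <= size f)%N -> degree_compatible f g.
Proof.
move=> ft gt gf; split=> //; have sf := top_sign_size ft.
case: ft gt => [fn f2 f1] [_ g2 g1]; rewrite lead_coefE.
have e2 : 0 < e ^+ 2.
  by rewrite exprn_even_gt0 //=; apply: contraTneq f1 => ->; rewrite mul0r ltxx.
rewrite -(pmulr_rge0 _ e2) expr2 mulrACA.
move: sf; rewrite leq_eqVlt => /predU1P[<- /=|sf]; first by rewrite mulr_ge0 // ltW.
have -> : size f = n.+2 by apply/eqP; rewrite eqn_leq fn.
by rewrite mulr_ge0.
Qed.

Lemma top_sign_blend e n f g t : top_sign e n f -> top_sign e n g -> 0 <= t <= 1 ->
  top_sign e n (blend f g t).
Proof.
move=> [fn f2 f1] [gn g2 g1] /andP[t0 t1]; split; first exact: size_blend_le.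
  by rewrite coef_blend; nra.
rewrite coef_blend; have [->|t1'] := eqVneq t 1; first by lra.
have : 0 < (1 - t) * (e * f`_n) by rewrite mulr_gt0 // subr_gt0 lt_neqAle t1'.
have : 0 <= t * (e * g`_n) by rewrite mulr_ge0 // ltW.
by lra.
Qed.

(** The blend is taken from the end of larger degree, so that the degree is
    constant until the other end. *)
Lemma top_sign_stable_blend b e n f g t : hstable f -> hstable g ->
    top_sign e n f -> top_sign e n g -> (0 < n)%N ->
    no_coef_of_parity b (g - f) -> 0 <= t <= 1 ->
  hstable (blend f g t).
Proof.
move=> fs gs ft gt n0 fgb t01.
have [fg|/ltnW gf] := leqP (size f) (size g); last first.
  apply: (stable_blend fs gs _ _ fgb t01); first exact: leq_trans (top_sign_size ft).
  exact: top_sign_compatible ft gt gf.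
rewrite blendC; apply: (stable_blend (b := b) gs fs).
- exact: leq_trans (top_sign_size gt).
- exact: top_sign_compatible gt ft fg.
- by move=> i ib; rewrite -opprB coefN fgb ?oppr0.
- by case/andP: t01 => t0 t1; rewrite subr_ge0 t1 lerBlDr lerDl.
Qed.

(** * Boxes of polynomials *)

Definition kharitonov_patterns : seq (seq nat) :=
  [:: [:: 2; 3]; [:: 0; 3]; [:: 0; 1]; [:: 1; 2]]%N.

(** Applied to the two top coefficients, this lets the four polynomials detect
    the signs of these coefficients over the whole box. *)
Lemma kharitonov_patterns_cover i (b c : bool) : exists2 pat,
  pat \in kharitonov_patterns &
  ((i %% 4)%N \in pat = b) /\ ((i.+1 %% 4)%N \in pat = c).
Proof.
rewrite -[i.+1]addn1 -(modnDml i 1 4); have : (i %% 4 < 4)%N by rewrite ltn_pmod.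
case: (i %% 4)%N => [|[|[|[|]]]] // _; case: b; case: c;
  solve [by exists [:: 2; 3]%N | by exists [:: 0; 3]%N | by exists [:: 0; 1]%N
        | by exists [:: 1; 2]%N].
Qed.

Lemma mod4E i : (i %% 4)%N = (odd i + (odd i./2).*2)%N.
Proof.
rewrite -{1}(odd_double_half i) -{1}(odd_double_half i./2) doubleD addnA.
rewrite -!muln2 -mulnA addnC modnMDl modn_small //.
by case: odd; case: odd.
Qed.

(** The bounds are the coefficients of two polynomials, so that the index ranges
    over all natural numbers, with bounds 0 beyond the degree. *)
Definition in_box lo hi f := forall i, lo`_i <= f`_i <= hi`_i.

Definition box_vertex lo hi (pat : seq nat) f :=
  forall i, f`_i = if (i %% 4)%N \in pat then hi`_i else lo`_i.

Lemma in_box_size lo hi f n : (size lo <= n)%N -> (size hi <= n)%N ->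
  in_box lo hi f -> (size f <= n)%N.
Proof.
move=> lon hin fb; apply/leq_sizeP => j nj; apply/le_anti.
have := fb j; rewrite [lo`_j]nth_default ?[hi`_j]nth_default ?(leq_trans _ nj) //.
by rewrite andbC.
Qed.

Lemma in_box_blend lo hi f g t : in_box lo hi f -> in_box lo hi g -> 0 <= t <= 1 ->
  in_box lo hi (blend f g t).
Proof.
move=> fb gb /andP[t0 t1] i; rewrite coef_blend.
by have /andP[? ?] := fb i; have /andP[? ?] := gb i; apply/andP; split; nra.
Qed.

Lemma between_blend (x y z : R) : x <= y <= z ->
  exists2 t, 0 <= t <= 1 & y = x + t * (z - x).
Proof.
move=> /andP[xy yz]; have [xz|zx] := ltP x z; last first.
  exists 0; first by rewrite lexx ler01.
  by rewrite mul0r addr0; apply/le_anti; rewrite xy (le_trans yz).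
have d0 : 0 < z - x by rewrite subr_gt0.
exists ((y - x) / (z - x)); last by rewrite divfK ?gt_eqF // addrC subrK.
by rewrite divr_ge0 ?subr_ge0 ?(ltW xz) //= ler_pdivrMr // mul1r lerB.
Qed.

Section Box.
Variables (n : nat) (lo hi k1 k2 k3 k4 : {poly R}).
Hypothesis lohi : forall i, lo`_i <= hi`_i.
Hypothesis size_lo : (size lo <= n.+2)%N.
Hypothesis size_hi : (size hi <= n.+2)%N.
Hypothesis lead_lohi : lo`_n.+1 != 0 \/ hi`_n.+1 != 0.
Hypothesis k1E : box_vertex lo hi [:: 2; 3]%N k1.
Hypothesis k2E : box_vertex lo hi [:: 0; 3]%N k2.
Hypothesis k3E : box_vertex lo hi [:: 0; 1]%N k3.
Hypothesis k4E : box_vertex lo hi [:: 1; 2]%N k4.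
Hypothesis k1s : hstable k1.
Hypothesis k2s : hstable k2.
Hypothesis k3s : hstable k3.
Hypothesis k4s : hstable k4.

Lemma vertex_in_box pat f : box_vertex lo hi pat f -> in_box lo hi f.
Proof. by move=> fE i; rewrite fE; case: ifP => _; rewrite lexx lohi. Qed.

Lemma stable_vertex pat : pat \in kharitonov_patterns ->
  exists2 f, box_vertex lo hi pat f & hstable f.
Proof.
by rewrite !inE => /or4P[] /eqP->; [exists k1|exists k2|exists k3|exists k4].
Qed.

Lemma stable_vertex_top (b c : bool) : exists f,
  [/\ in_box lo hi f, hstable f, f`_n = (if b then hi else lo)`_n
    & f`_n.+1 = (if c then hi else lo)`_n.+1].
Proof.
have [pat /stable_vertex[f fE fs] [sb sc]] := kharitonov_patterns_cover n b c.
exists f; split=> //; first exact: vertex_in_box fE.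
  by rewrite fE sb; case: b {sb}.
by rewrite fE sc; case: c {sc}.
Qed.

(** Each of the four pairs of endpoints for the two top coefficients occurs in
    a stable vertex, where the two have the same sign unless the top one is 0.
    A nonzero endpoint for the top coefficient then fixes all signs. *)
Lemma box_top_sign : exists e, forall f, in_box lo hi f -> top_sign e n f.
Proof.
pose v (b : bool) := (if b then hi else lo)`_n.
pose u (c : bool) := (if c then hi else lo)`_n.+1.
have uv b c : u c != 0 -> 0 < u c * v b.
  have [f [fb fs Ev Eu]] := stable_vertex_top b c.
  rewrite /v /u -Ev -Eu => ?; apply: stable_top_coefs => //.
  exact: in_box_size size_lo size_hi fb.
have [c e0] : exists c, u c != 0.
  by case: lead_lohi => ?; [exists false | exists true].
have ev b : 0 < u c * v b by exact: uv.
have eu c' : 0 <= u c * u c'.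
  have [->|/(uv true) h1] := eqVneq (u c') 0; first by rewrite mulr0.
  have h2 := ev true; apply: ltW.
  have : 0 < (u c * v true) * (u c' * v true) by rewrite mulr_gt0.
  rewrite mulrACA pmulr_lgt0 // -expr2 exprn_even_gt0 //=.
  by apply: contraTneq h2 => ->; rewrite mulr0 ltxx.
exists (u c) => f fb; split; first exact: in_box_size size_lo size_hi fb.
  have /andP[l h] := fb n.+1; have := eu true; have := eu false; rewrite /u -/(u c).
  by case: (ltP 0 (u c)) => ? ? ?; nra.
have /andP[l h] := fb n; have := ev true; have := ev false; rewrite /v.
by case: (ltP 0 (u c)) => ? ? ?; nra.
Qed.

Lemma box_size f : in_box lo hi f -> (size f <= n.+2)%N.
Proof. exact: in_box_size. Qed.

(** For [0 <= w] the sign of the real or imaginary part of [(iw)^i] depends on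
    [i] modulo 4 only; the Kharitonov patterns follow these signs. *)
Lemma Re_box f w : 0 <= w -> in_box lo hi f ->
  Re (cev k1 (imag w)) <= Re (cev f (imag w)) <= Re (cev k2 (imag w)).
Proof.
move=> w0 fb; have b1 := vertex_in_box k1E; have b2 := vertex_in_box k2E.
rewrite !(@ReE _ n.+2) ?box_size //.
apply/andP; split; apply: ler_sum => i _; have /andP[l h] := fb i;
  have wi := exprn_ge0 i w0; rewrite ?k1E ?k2E mod4E Re_imagX -signr_odd;
  by case: (odd i); case: (odd i./2) => /=; rewrite ?mulr0 ?expr0 ?expr1 //; nra.
Qed.

Lemma Im_box f w : 0 <= w -> in_box lo hi f ->
  Im (cev k1 (imag w)) <= Im (cev f (imag w)) <= Im (cev k4 (imag w)).
Proof.
move=> w0 fb; have b1 := vertex_in_box k1E; have b4 := vertex_in_box k4E.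
rewrite !(@ImE _ n.+2) ?box_size //.
apply/andP; split; apply: ler_sum => i _; have /andP[l h] := fb i;
  have wi := exprn_ge0 i w0; rewrite ?k1E ?k4E mod4E Im_imagX -signr_odd;
  by case: (odd i); case: (odd i./2) => /=; rewrite ?mulr0 ?expr0 ?expr1 //; nra.
Qed.

Lemma vertex_diff_parity b pat pat' f g :
  box_vertex lo hi pat f -> box_vertex lo hi pat' g ->
  (forall i, odd i = b -> ((i %% 4)%N \in pat) = ((i %% 4)%N \in pat')) ->
  no_coef_of_parity b (g - f).
Proof. by move=> fE gE ss i ib; rewrite coefB fE gE ss // subrr. Qed.

Lemma parity_k12 : no_coef_of_parity true (k2 - k1).
Proof.
by apply: (vertex_diff_parity k1E k2E) => i; rewrite mod4E => ->; case: odd.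
Qed.
Lemma parity_k43 : no_coef_of_parity true (k3 - k4).
Proof.
by apply: (vertex_diff_parity k4E k3E) => i; rewrite mod4E => ->; case: odd.
Qed.
Lemma parity_k14 : no_coef_of_parity false (k4 - k1).
Proof.
by apply: (vertex_diff_parity k1E k4E) => i; rewrite mod4E => ->; case: odd.
Qed.
Lemma parity_k23 : no_coef_of_parity false (k3 - k2).
Proof.
by apply: (vertex_diff_parity k2E k3E) => i; rewrite mod4E => ->; case: odd.
Qed.

Lemma hull_stable s t : (0 < n)%N -> 0 <= s <= 1 -> 0 <= t <= 1 ->
  hstable (blend (blend k1 k2 s) (blend k4 k3 s) t).
Proof.
move=> n0 s01 t01; have [e et] := box_top_sign.
have t1 := et _ (vertex_in_box k1E); have t2 := et _ (vertex_in_box k2E).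
have t3 := et _ (vertex_in_box k3E); have t4 := et _ (vertex_in_box k4E).
apply: (@top_sign_stable_blend false e n _ _ _ _ _ _ _ n0 _ t01).
- exact: top_sign_stable_blend k1s k2s t1 t2 n0 parity_k12 s01.
- exact: top_sign_stable_blend k4s k3s t4 t3 n0 parity_k43 s01.
- exact: top_sign_blend.
- exact: top_sign_blend.
move=> i /[dup] /parity_k14 + /parity_k23; rewrite !coefB !coef_blend => h1 h2.
have -> : k4`_i = k1`_i by apply/eqP; rewrite -subr_eq0 h1.
have -> : k3`_i = k2`_i by apply/eqP; rewrite -subr_eq0 h2.
by rewrite subrr.
Qed.

(** The values at [iw] of the polynomials of the box fill the rectangle with
    corners the values of the four vertices, and every point of this rectangle is
    also the value of a stable member of the bilinear hull of these vertices. *)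
Lemma box_imag_neq0 f w : (0 < n)%N -> 0 <= w -> in_box lo hi f -> cev f (imag w) != 0.
Proof.
move=> n0 w0 fb.
have [s s01 Es] := between_blend (Re_box w0 fb).
have [t t01 Et] := between_blend (Im_box w0 fb).
have /stableP/(_ (imag w) (lexx _)) := hull_stable n0 s01 t01.
congr (_ != 0).
have := Im_even_poly w parity_k12; have := Im_even_poly w parity_k43.
have := Re_odd_poly w parity_k14; have := Re_odd_poly w parity_k23.
rewrite !cevB !cev_blend => h1 h2 h3 h4.
apply/eqP; rewrite eq_complex; move: h1 h2 h3 h4.
rewrite !(ReD, ImD, ReN, ImN, ReM, ImM) /= Es Et => h1 h2 h3 h4.
by apply/andP; split; apply/eqP; nra.
Qed.

Lemma box_stable f : in_box lo hi f -> hstable f.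
Proof.
move=> fb; have [e et] := box_top_sign.
have [n0|n0] := posnP n; first by apply: (linear_stable (e := e)); rewrite -n0; apply: et.
have [k [kb ks k0]] : exists k, [/\ in_box lo hi k, hstable k & k`_n.+1 != 0].
  have [?|?] := lead_lohi.
    by have [k [? ? _ E]] := stable_vertex_top true false; exists k; rewrite E.
  by have [k [? ? _ E]] := stable_vertex_top true true; exists k; rewrite E.
apply: (zero_exclusion ks) => [|t w t01 w0]; last first.
  by apply: box_imag_neq0 => //; apply: in_box_blend.
apply: (top_sign_compatible (et _ kb) (et _ fb)).
apply: leq_trans (box_size fb) _; rewrite ltnNge; apply: contra k0 => ?.
by rewrite nth_default.
Qed.

End Box.
End HurwitzStability.

(** * Interval polynomials *)

Lemma coef_poly_of_coefs (R : realType) (n : nat) (a : 'I_n.+1 -> R) (i : 'I_n.+1) :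
  (poly_of_coefs a)`_i = a i.
Proof.
rewrite /poly_of_coefs coef_sum (bigD1 i) //= coefZ coefXn eqxx mulr1.
rewrite big1 ?addr0 // => j ji; rewrite coefZ coefXn eq_sym.
by rewrite (inj_eq val_inj) (negbTE ji) mulr0.
Qed.

Lemma size_poly_of_coefs (R : realType) (n : nat) (a : 'I_n.+1 -> R) :
  (size (poly_of_coefs a) <= n.+1)%N.
Proof.
apply: (leq_trans (size_sum _ _ _)); apply/bigmax_leqP => i _.
by apply: leq_trans (size_scale_leq _ _) _; rewrite size_polyXn.
Qed.

Lemma kharitonov_vertex (R : realType) (n : nat) (am ap : 'I_n.+1 -> R) pat :
  box_vertex (poly_of_coefs am) (poly_of_coefs ap) pat (kharitonov am ap pat).
Proof.
move=> j; have [nj|j_lt] := leqP n.+1 j.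
  by rewrite !nth_default ?(leq_trans _ nj) ?size_poly_of_coefs ?if_same.
by rewrite -[j]/(val (Ordinal j_lt)) !coef_poly_of_coefs.
Qed.

Lemma kharitonov_in_interval (R : realType) (n : nat) (am ap : 'I_n.+1 -> R) pat :
  (forall i, am i <= ap i) -> interval_poly am ap (kharitonov am ap pat).
Proof.
move=> ham_ap; eexists; last by [].
by move=> i /=; case: ifP => _; rewrite lexx ham_ap.
Qed.

Lemma interval_in_box (R : realType) (n : nat) (am ap : 'I_n.+1 -> R) p :
  interval_poly am ap p -> in_box (poly_of_coefs am) (poly_of_coefs ap) p.
Proof.
move=> [a ha ->] j; have [nj|j_lt] := leqP n.+1 j.
  by rewrite !nth_default ?(leq_trans _ nj) ?size_poly_of_coefs ?lexx.
by rewrite -[j]/(val (Ordinal j_lt)) !coef_poly_of_coefs.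
Qed.

Lemma const_stable (R : realType) (p : {poly R}) :
  (size p <= 1)%N -> hurwitz_stable p <-> p`_0 != 0.
Proof.
move=> p1; split=> [/stable_neq0|p0].
  by rewrite {1}(size1_polyC p1) polyC_eq0.
by apply/stableP => z _; rewrite (size1_polyC p1) /cev map_polyC hornerC fmorph_eq0.
Qed.

Theorem theorem1 (R : realType) (n : nat) (am ap : 'I_n.+1 -> R)
    (ham_ap : forall i, am i <= ap i)
    (hlead : am ord_max != 0 \/ ap ord_max != 0)
    (hproper : exists i, am i < ap i)
    (hconst : n = 0%N -> ~ (am ord0 < 0 < ap ord0)) :
  interval_hurwitz_stable (interval_poly am ap) <->
  [/\ hurwitz_stable (kharitonov1 am ap),
      hurwitz_stable (kharitonov2 am ap),
      hurwitz_stable (kharitonov3 am ap) &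
      hurwitz_stable (kharitonov4 am ap)].
Proof.
split=> [st | [k1s k2s k3s k4s] p pP].
  by split; apply/st/kharitonov_in_interval.
have pb := interval_in_box pP.
have szp := in_box_size (size_poly_of_coefs am) (size_poly_of_coefs ap) pb.
have [n0|n0] := posnP n.
  (* k1 and k2 are the end points, and 0 cannot lie strictly between them *)
  subst n; move: k1s k2s.
  rewrite !const_stable ?size_poly_of_coefs // !kharitonov_vertex /=.
  rewrite (coef_poly_of_coefs am ord0) (coef_poly_of_coefs ap ord0).
  have := pb 0%N; rewrite (coef_poly_of_coefs am ord0) (coef_poly_of_coefs ap ord0).
  move=> /andP[l h] m0 p0; apply/eqP => E; apply: (hconst erefl).
  by rewrite !lt_neqAle m0 eq_sym p0 -{1}E -{2}E l h.
move: n0 am ap ham_ap hlead {hproper hconst} k1s k2s k3s k4s pP pb szp.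
case: n => // n _ am ap ham_ap hlead k1s k2s k3s k4s _ pb _.
apply: (box_stable _ _ _ _ (kharitonov_vertex _ _ _) (kharitonov_vertex _ _ _)
  (kharitonov_vertex _ _ _) (kharitonov_vertex _ _ _) k1s k2s k3s k4s pb).
- by move=> i; have /andP[l h] := pb i; apply: le_trans l h.
- exact: size_poly_of_coefs.
- exact: size_poly_of_coefs.
- by rewrite (coef_poly_of_coefs am ord_max) (coef_poly_of_coefs ap ord_max).
Qed.
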